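(* Let $G$ be a non locally cyclic group. Then the non-cyclic graph $\Gamma_G$ is connected and $\operatorname{diam}(\Gamma_G)\leq 3$. Moreover, if $Z(G)=Cyc(G)$, then $\operatorname{diam}(\Gamma_G)=2$.
   Context: A group is locally cyclic if each of its finitely generated subgroups is cyclic. For a group $G$, $Cyc(G)=\{x\in G : \langle x,y\rangle \text{ is cyclic for all } y\in G\}$, and $Z(G)$ is the center of $G$. For a non locally cyclic group $G$ (possibly infinite), the non-cyclic graph $\Gamma_G$ is the simple graph with vertex set $G\setminus Cyc(G)$ in which two distinct vertices $x,y$ are adjacent if and only if $\langle x,y\rangle$ is not cyclic. $\operatorname{diam}$ denotes the diameter of a graph. *)

(* Defs.v *)
From mathcomp Require Import all_boot all_order all_algebra.
From mathcomp Require Import boolp classical_sets functions cardinality.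
From mathcomp Require Import constructive_ereal.

Set Implicit Arguments.
Unset Strict Implicit.
Unset Printing Implicit Defensive.

Local Open Scope classical_set_scope.

Section Groups.
Variable G : groupType.
Implicit Types (A H : set G) (x y : G).

Definition generated A : set G :=
  smallest [set H : set G | group_closed [in H]] A.

Definition is_cyclic H : Prop := exists x, H = generated [set x].

Definition finitely_generated H : Prop :=
  exists A, finite_set A /\ H = generated A.

Definition locally_cyclic : Prop :=
  forall H, finitely_generated H -> is_cyclic H.

Definition Cyc : set G :=
  [set x | forall y, is_cyclic (generated [set x; y])].

Definition center : set G := [set x | forall y, commute x y].

End Groups.

Arguments locally_cyclic : clear implicits.
Arguments Cyc : clear implicits.
Arguments center : clear implicits.

Record sgraph := SGraph {
  vertex : choiceType;
  adj : rel vertex;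
  adj_sym : symmetric adj;
  adj_irr : irreflexive adj
}.

Section Graphs.
Variable X : sgraph.
Implicit Types (x y : vertex X) (p : seq (vertex X)).

(* A path from x to y is given by the list p of its vertices after x, so that
   its length (number of edges) is size p. *)
Definition is_path x y p : Prop :=
  [/\ path (@adj X) x p, uniq (x :: p) & last x p = y].

(* The graph without vertices is not connected. *)
Definition connected_graph : Prop :=
  (exists x : vertex X, True) /\ forall x y, exists p, is_path x y p.

(* Distances and diameters live in the extended integers; the distance between
   two vertices that no path joins is +oo. *)
Definition dist x y : \bar int :=
  infimum +oo%E [set (Posz (size p))%:E | p in is_path x y].

Definition diam : \bar int :=
  supremum 0%E [set d | exists x y, d = dist x y].

End Graphs.

Section NonCyclicGraph.
Variable G : groupType.

Let V : choiceType := set_type (~` Cyc G).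

Definition noncyclic_adj : rel V := fun x y =>
  (x != y) && `[< ~ is_cyclic (generated [set val x; val y]) >].

Lemma noncyclic_adj_sym : symmetric noncyclic_adj.
Proof. by move=> x y; rewrite /noncyclic_adj eq_sym setUC. Qed.

Lemma noncyclic_adj_irr : irreflexive noncyclic_adj.
Proof. by move=> x; rewrite /noncyclic_adj eqxx. Qed.

(* For every group G; the vertex type is empty when G is locally cyclic. *)
Definition noncyclic_graph : sgraph :=
  SGraph noncyclic_adj_sym noncyclic_adj_irr.

End NonCyclicGraph.

Arguments noncyclic_graph : clear implicits.

(* Main.v *)
(** Two elements generate a cyclic group exactly when they lie in a common
    cyclic subgroup.  Let [x], [y] be vertices with neighbours [a], [b].  If
    [x, a, b, y] is not a walk, then [a] and [b] lie in a common cyclic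
    subgroup [<d>]; now [d] is adjacent to [x], as [a] lies in [<d>], and
    likewise to [y], so that [x, d, y] is a walk.

    If [Z(G) = Cyc(G)], the centralizers of [x] and [y] are proper subgroups,
    so they do not cover [G], and any element outside both is a common
    neighbour.  The diameter is not 1 because a vertex [x] with
    [x <> x^-1] is not adjacent to its inverse; if there were none, all
    noncentral elements, hence all elements, would square to 1 and [G] would
    be abelian. *)
Require Import Defs.
From mathcomp Require Import all_boot all_order all_algebra.
From mathcomp Require Import boolp classical_sets constructive_ereal.
From mathcomp Require Import cardinality.

Set Implicit Arguments.
Unset Strict Implicit.
Unset Printing Implicit Defensive.

Import Order.TTheory.

Local Open Scope classical_set_scope.

(** * Cyclic subgroups, [Cyc] and centralizers *)

Section Generated.
Local Open Scope group_scope.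
Variable G : groupType.
Implicit Types (A H : set G) (x y z c d : G).

Lemma generated_group A : group_closed [in generated A].
Proof.
split=> [|x y]; rewrite !inE; first by move=> H [[H1 _] _]; rewrite inE in H1.
move=> Ax Ay H HA; have [/= [_ HB] _] := HA.
by have /= := HB x y; rewrite !inE; apply; [apply: Ax|apply: Ay].
Qed.

Lemma generated_sub A H :
  group_closed [in H] -> A `<=` H -> generated A `<=` H.
Proof. exact: smallest_sub. Qed.

Lemma mem_generated A x : A x -> generated A x.
Proof. exact: sub_gen_smallest. Qed.

Lemma cycle_sub c d : generated [set d] c ->
  generated [set c] `<=` generated [set d].
Proof. by move=> dc; apply: generated_sub (generated_group _) _ => _ ->. Qed.

Lemma set_group1 H : group_closed [in H] -> H 1.
Proof. by case; rewrite inE. Qed.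

Lemma set_groupF H x y : group_closed [in H] -> H x -> H y -> H (x / y).
Proof.
by move=> [_ HF] Hx Hy; have := HF x y; rewrite !in_setE; apply.
Qed.

Lemma set_groupV H x : group_closed [in H] -> H x -> H x^-1.
Proof.
by move=> Hg Hx; rewrite -div1g; apply: set_groupF (set_group1 Hg) Hx.
Qed.

Lemma set_groupX H x n : group_closed [in H] -> H x -> H (x ^+ n).
Proof.
move=> Hg Hx; elim: n => [|n IHn]; first exact: set_group1.
rewrite expgSr -[x in _ * x]invgK.
by apply: set_groupF => //; apply: set_groupV.
Qed.

Lemma cycleP c x :
  generated [set c] x <-> exists n, x = c ^+ n \/ x = c ^- n.
Proof.
have cg := generated_group [set c]; split; last first.
  have cX n : generated [set c] (c ^+ n).
    exact: set_groupX cg (mem_generated (erefl c)).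
  by case=> n [] ->; [apply: cX | apply: (set_groupV cg (cX n))].
(* Quotients of natural powers are closed under division with no case analysis on the sign of an
   exponent. *)
pose H := [set x | exists m n, x = c ^+ m / c ^+ n].
suff : generated [set c] `<=` H.
  move=> cH /cH [m [n ->]]; case: (leqP n m) => [nm|/ltnW mn].
    by exists (m - n)%N; left; rewrite expgnFr.
  by exists (n - m)%N; right; rewrite expgnFr // invgF.
apply: generated_sub => [|_ ->]; last first.
  by exists 1%N, 0%N; rewrite expg1 expg0 invg1 mulg1.
split=> [|u v]; rewrite !inE; first by exists 0%N, 0%N; rewrite expg0 mulgV.
move=> [m [n ->]] [p [q ->]]; exists (m + q)%N, (p + n)%N.
have cX k l : commute (c ^+ k) (c ^+ l) by apply/commuteX2/commute_refl.
rewrite invgF !expgnDr invgM -!mulgA; congr (_ * _).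
rewrite !mulgA; congr (_ * _).
exact: commute_sym (commuteV (cX q n)).
Qed.

Lemma cycle_commute c x y :
  generated [set c] x -> generated [set c] y -> commute x y.
Proof.
have cX k l : commute (c ^+ k) (c ^+ l) by apply/commuteX2/commute_refl.
have cV (u v : G) : commute u v -> commute u^-1 v.
  by move=> uv; apply: commute_sym (commuteV (commute_sym uv)).
move=> /cycleP[m xE] /cycleP[n yE].
by case: xE yE => -> [] ->; do ?[apply: commuteV|apply: cV].
Qed.

(** The generator is the power of [c] with the least positive exponent occurring in [H]; division
    with remainder shows that it divides every other exponent. *)
Lemma subcycle_cyclic H c :
  group_closed [in H] -> H `<=` generated [set c] -> is_cyclic H.
Proof.
move=> Hg Hc.
have Hn x : H x -> exists2 n, H (c ^+ n) & x = c ^+ n \/ x = c ^- n.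
  move=> Hx; have /cycleP[n xE] := Hc x Hx; exists n => //.
  case: xE => xE; first by rewrite -xE.
  by rewrite -[c ^+ n]invgK -xE; apply: set_groupV.
suff [n0 Hn0 n0P] :
    exists2 n0, H (c ^+ n0) & forall n, H (c ^+ n) -> (n0 %| n)%N.
  exists (c ^+ n0); apply/seteqP; split; last first.
    by apply: generated_sub => // _ ->.
  move=> x /Hn[n /n0P/dvdnP[k ->] xE]; apply/cycleP; exists k.
  by rewrite -expgnA mulnC.
have [/asboolP P|/asboolPn nP] :=
  boolP `[< exists n, (0 < n)%N && `[< H (c ^+ n) >] >]; last first.
  (* With no positive exponent [H] is trivial, and 0 serves since it divides only 0. *)
  exists 0%N => [|n Hcn]; first exact: set_group1.
  by case: n Hcn => // n Hcn; case: nP; exists n.+1; apply/asboolP.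
case: (ex_minnP P) => n0 /andP[n0_gt0 /asboolP Hn0] n0min.
exists n0 => // n Hcn; rewrite /dvdn; apply: contraTT isT => r_neq0 /=.
have Hr : H (c ^+ (n %% n0)).
  have -> : c ^+ (n %% n0) = c ^+ n / c ^+ n0 ^+ (n %/ n0).
    rewrite -expgnA mulnC -expgnFr ?leq_divM //; congr (_ ^+ _).
    by rewrite {2}(divn_eq n n0) addKn.
  by apply: set_groupF => //; apply: set_groupX.
have := n0min (n %% n0)%N; rewrite lt0n r_neq0 leqNgt ltn_pmod //.
by move=> /(_ (asboolT Hr)).
Qed.

Lemma cyclic_pairP x y : is_cyclic (generated [set x; y]) <->
  exists c, generated [set c] x /\ generated [set c] y.
Proof.
split=> [[c xyE]|[c [cx cy]]].
  by exists c; rewrite -xyE; split; apply: mem_generated; [left|right].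
apply: (@subcycle_cyclic _ c); first exact: generated_group.
by apply: generated_sub (generated_group _) _ => _ [] ->.
Qed.

Lemma cyclic_pair_commute x y :
  is_cyclic (generated [set x; y]) -> commute x y.
Proof. by case/cyclic_pairP => c [cx cy]; apply: (cycle_commute cx cy). Qed.

Lemma cyclic_pair_sub x c d : generated [set d] c ->
  is_cyclic (generated [set x; d]) -> is_cyclic (generated [set x; c]).
Proof.
move=> dc /cyclic_pairP[e [ex ed]]; apply/cyclic_pairP; exists e.
by split=> //; apply: cycle_sub ed _ dc.
Qed.

(** Generators are absorbed one at a time: if [c] generates a cyclic group containing the earlier
    ones, the next generator and [c] lie in a common cyclic subgroup. *)
Lemma Cyc_setT_locally_cyclic : Cyc G = setT -> locally_cyclic G.
Proof.
move=> CycT _ [A [/finite_seqP[s ->] ->]].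
suff [c cs] : exists c, [set` s] `<=` generated [set c].
  apply: (@subcycle_cyclic _ c); first exact: generated_group.
  exact: generated_sub (generated_group _) cs.
elim: s => [|x s [c cs]]; first by exists 1 => y.
have : Cyc G x by rewrite CycT.
move=> /(_ c)/cyclic_pairP[d [dx dc]]; exists d => y /=.
by rewrite inE => /orP[/eqP-> //|/cs]; apply: cycle_sub.
Qed.

Lemma noncentral_pair x y : ~ center G x -> ~ center G y ->
  exists z, ~ commute x z /\ ~ commute y z.
Proof.
move=> /existsNP[a xa] /existsNP[b yb].
have [ya|ya] := pselect (commute y a); last by exists a.
have [xb|xb] := pselect (commute x b); last by exists b.
(* Here [a] commutes with [y] but not with [x], and [b] with [x] but not with [y], so the product
   commutes with neither. *)
exists (a * b); split=> [xab|yab].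
  by apply: xa; rewrite -(mulgK b a); apply: commuteM => //; apply: commuteV.
by apply: yb; rewrite -(mulKg a b); apply: commuteM => //; apply: commuteV.
Qed.

Lemma noncentral_neq_inv :
  (exists x, ~ center G x) -> exists2 x, ~ center G x & x <> x^-1.
Proof.
move=> [x Zx]; apply: contrapT => noinv.
have invE y : ~ center G y -> y = y^-1.
  by move=> Zy; apply: contrapT => yV; apply: noinv; exists y.
suff invT y : y = y^-1.
  by apply: Zx => y; rewrite /commute (invT (x * y)) invgM -!invT.
have [Zy|] := pselect (center G y); last exact: invE.
(* A central [y] is reached through the noncentral [x * y]: once [x] and [x * y] are their own
   inverses, [y * x = y^-1 * x], and [x] cancels. *)
have Zxy : ~ center G (x * y).
  move=> Zxy; apply: Zx => z; apply: commute_sym.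
  rewrite -(mulgK y x); apply: commuteM; first exact: commute_sym (Zxy z).
  exact: commuteV (commute_sym (Zy z)).
by have := invE _ Zxy; rewrite invgM -(invE _ Zx) -(Zy x) => /mulIg.
Qed.

End Generated.

(** * Distances and diameters from walks *)

Section Distance.
Variable X : sgraph.
Implicit Types (x y : vertex X) (p : seq (vertex X)).

Lemma dist_min x y p : is_path x y p ->
  (forall q, is_path x y q -> (size p <= size q)%N) ->
  dist x y = (Posz (size p))%:E.
Proof.
move=> xyp pmin; rewrite /dist /infimum ifF; last first.
  by apply/negbTE/set0P; exists (Posz (size p))%:E, p.
apply: xget_unique => [|d [lb_d ub_d]].
  split=> [_ [q xyq <-]|d]; first by rewrite lee_fin lez_nat pmin.
  by apply; exists p.
apply/eqP; rewrite eq_le lb_d /=; last by exists p.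
by apply: ub_d => _ [q xyq <-]; rewrite lee_fin lez_nat pmin.
Qed.

(** Removing loops turns a walk into a path that is no longer, and a shortest path exists because
    lengths are natural numbers. Bounding a distance thus only takes a walk, whose vertices may
    repeat. *)
Lemma dist_walk x y p : path (@adj X) x p -> last x p = y ->
  exists q, [/\ is_path x y q, (size q <= size p)%N &
                dist x y = (Posz (size q))%:E].
Proof.
move=> xp py; have [q xyq qp] : exists2 q, is_path x y q & (size q <= size p)%N.
  move: py; case/shortenP: xp => q xq uq sub_qp qy; exists q => //.
  by apply: uniq_leq_size => [|z /sub_qp//]; case/andP: uq.
have ex : exists n, `[< exists2 r, is_path x y r & size r = n >].
  by exists (size q); apply/asboolP; exists q.
case: (ex_minnP ex) => _ /asboolP[r xyr <-] rmin.
have {}rmin s : is_path x y s -> (size r <= size s)%N.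
  by move=> xys; apply: rmin; apply/asboolP; exists s.
exists r; split=> //; first exact: leq_trans (rmin _ xyq) qp.
exact: dist_min.
Qed.

Lemma diam_max (d : \bar int) x y : dist x y = d ->
  (forall u v : vertex X, (dist u v <= d)%E) -> diam X = d.
Proof.
move=> xyd dub; rewrite /diam /supremum ifF; last first.
  by apply/negbTE/set0P; exists d, x, y.
apply: xget_unique => [|e [ub_e lb_e]].
  by split=> [_ [u [v ->]]|e]; [apply: dub | apply; exists x, y].
apply/eqP; rewrite eq_le ub_e ?andbT; last by exists x, y.
by apply: lb_e => _ [u [v ->]]; apply: dub.
Qed.

Lemma diam_le k :
  (forall x y : vertex X, exists2 n, (n <= k)%N & dist x y = (Posz n)%:E) ->
  (diam X <= (Posz k)%:E)%E.
Proof.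
move=> distk; have [[x _]|noX] :=
  pselect (exists x : vertex X, True); last first.
  (* Without vertices the supremum takes its default value 0. *)
  rewrite /diam /supremum ifT ?lee_fin //; apply/eqP/seteqP; split=> // d.
  by case=> x; case: noX; exists x.
(* The distances are natural numbers bounded by [k], so a largest one is attained and [diam_max]
   applies. *)
pose P n := `[< exists u v : vertex X, dist u v = (Posz n)%:E >].
have exP : exists n, P n.
  by have [n _ xxn] := distk x x; exists n; apply/asboolP; exists x, x.
have Pk n : P n -> (n <= k)%N.
  move=> /asboolP[u [v uvn]]; have [m mk] := distk u v.
  by rewrite uvn => -[->].
case: (ex_maxnP exP Pk) => n Pn nmax; have /asboolP[u [v uvn]] := Pn.
rewrite (diam_max uvn) ?lee_fin ?lez_nat ?Pk // => u' v'.
have [m _ mE] := distk u' v'; rewrite mE lee_fin lez_nat nmax //.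
by apply/asboolP; exists u', v'.
Qed.

End Distance.

(** * Walks in the non-cyclic graph *)

Section NonCyclicGraph.
Variable G : groupType.
Notation V := (vertex (noncyclic_graph G)).
Implicit Types (x y : V) (g h : G).

Lemma noncyclic_vertex g h : ~ is_cyclic (generated [set g; h]) ->
  exists x : V, val x = g.
Proof.
move=> gh; have Vg : g \in ~` Cyc G by rewrite inE => /(_ h).
by exists (SigSub Vg).
Qed.

Lemma noncyclic_adjP x y :
  reflect (~ is_cyclic (generated [set val x; val y])) (adj x y).
Proof.
apply: (iffP andP) => [[_ /asboolP]//|xy]; split; last exact/asboolP.
(* Distinctness is automatic, as equal elements lie in the cyclic group of either. *)
apply/eqP => xyE; apply: xy; apply/cyclic_pairP; exists (val x).
by rewrite xyE; split; apply: mem_generated.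
Qed.

Lemma noncyclic_neighbour x : exists y, adj x y.
Proof.
have : ~ Cyc G (val x) by have := valP x; rewrite inE.
move=> /existsNP[g xg]; have [y yE] : exists y : V, val y = g.
  by apply: (@noncyclic_vertex _ (val x)); rewrite setUC.
by exists y; apply/noncyclic_adjP; rewrite yE.
Qed.

Lemma noncyclic_common_neighbour x y g :
  ~ is_cyclic (generated [set val x; g]) ->
  ~ is_cyclic (generated [set val y; g]) -> exists z, adj x z && adj z y.
Proof.
move=> xg yg; have [z zE] : exists z : V, val z = g.
  by apply: (@noncyclic_vertex _ (val x)); rewrite setUC.
exists z; rewrite (adj_sym z); apply/andP; split; apply/noncyclic_adjP;
  by rewrite zE.
Qed.

Lemma noncyclic_walk3 x y :
  exists p, [/\ path (@adj _) x p, last x p = y & (size p <= 3)%N].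
Proof.
have [a xa] := noncyclic_neighbour x; have [b yb] := noncyclic_neighbour y.
have [ab|/noncyclic_adjP] := boolP (adj a b).
  by rewrite adj_sym in yb; exists [:: a; b; y]; split=> //; apply/and4P.
move=> /contrapT/cyclic_pairP[d [da db]].
move: xa yb => /noncyclic_adjP xa /noncyclic_adjP yb.
have [z /andP[xz zy]] : exists z, adj x z && adj z y.
  apply: (@noncyclic_common_neighbour _ _ d).
    by move=> /(cyclic_pair_sub da).
  by move=> /(cyclic_pair_sub db).
by exists [:: z; y]; split=> //; apply/and3P.
Qed.

Lemma noncyclic_walk2 x y : center G = Cyc G ->
  exists p, [/\ path (@adj _) x p, last x p = y & (size p <= 2)%N].
Proof.
move=> ZE; have ncV (u : V) : ~ center G (val u).
  by rewrite ZE; have := valP u; rewrite inE.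
have [g [xg yg]] := noncentral_pair (ncV x) (ncV y).
have [z /andP[xz zy]] : exists z, adj x z && adj z y.
  by apply: (@noncyclic_common_neighbour _ _ g) => /cyclic_pair_commute.
by exists [:: z; y]; split=> //; apply/and3P.
Qed.

Lemma noncyclic_vertex_exists : ~ locally_cyclic G -> exists x : V, True.
Proof.
move=> nlc; apply: contrapT => noV; apply: nlc.
apply: Cyc_setT_locally_cyclic; apply/seteqP; split=> // g _ h.
by apply: contrapT => /noncyclic_vertex[x _]; apply: noV; exists x.
Qed.

Lemma noncyclic_dist2 : center G = Cyc G -> (exists x : V, True) ->
  exists x y : V, dist x y = (Posz 2)%:E.
Proof.
move=> ZE [u _]; have [g Zg gV] : exists2 g, ~ center G g & g <> g^-1%g.
  apply: noncentral_neq_inv; exists (val u).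
  by rewrite ZE; have := valP u; rewrite inE.
have ZgV : ~ center G g^-1%g.
  move=> Zg'; apply: Zg => h; apply: commute_sym; rewrite -(invgK g).
  exact: commuteV (commute_sym (Zg' h)).
have toV h : ~ center G h -> exists x : V, val x = h.
  by rewrite ZE => /existsNP[h' /noncyclic_vertex].
have [x xE] := toV _ Zg; have [y yE] := toV _ ZgV; exists x, y.
have [p [xp py p2]] := noncyclic_walk2 x y ZE.
have [q [xyq qp ->]] := dist_walk xp py; congr (Posz _)%:E.
apply/eqP; rewrite eqn_leq (leq_trans qp p2) /=.
(* Length 0 would give [g = g^-1]; length 1 would make [g] and [g^-1] adjacent, although both lie in
   the cyclic group of [g]. *)
case: q xyq {qp} => [|v [|w q]] //= [xq _ qy].
  by case: gV; rewrite -yE -qy xE.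
move: xq; rewrite /= in qy; rewrite qy => /andP[/noncyclic_adjP[]].
apply/cyclic_pairP.
exists g; rewrite xE yE; have gg := @mem_generated G [set g] g erefl.
by split=> //; apply: (set_groupV (generated_group _) gg).
Qed.

End NonCyclicGraph.

Theorem proposition3p2 (G : groupType) (hG : ~ locally_cyclic G) :
  connected_graph (noncyclic_graph G) /\
  (diam (noncyclic_graph G) <= (3%:Z)%:E)%E /\
  (center G = Cyc G -> diam (noncyclic_graph G) = (2%:Z)%:E).
Proof.
have V_neq0 := noncyclic_vertex_exists hG.
split; first split=> // x y.
  have [p [xp py _]] := noncyclic_walk3 x y.
  by have [q [xyq _ _]] := dist_walk xp py; exists q.
split=> [|ZE].
  apply: diam_le => x y; have [p [xp py p3]] := noncyclic_walk3 x y.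
  have [q [_ qp xyE]] := dist_walk xp py.
  by exists (size q) => //; apply: leq_trans qp p3.
have [x [y xyE]] := noncyclic_dist2 ZE V_neq0.
apply: (diam_max xyE) => u v.
have [p [up pv p2]] := noncyclic_walk2 u v ZE.
have [q [_ qp ->]] := dist_walk up pv.
by rewrite lee_fin lez_nat (leq_trans qp p2).
Qed.
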